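(* Let $G$ be a finite simple graph and let $m\geq 1$ be an integer. If $G$ is triangle-free with at least two edges and $d_{\min}(G)\geq 1$, then $d_{\min}(\mathsf{M}_m(G))\geq d_{\min}(G)+2$.
   Context: Graphs are finite, without loops or multiple edges. An orientation is acyclic if it contains no directed cycle. An arc of an acyclic orientation $D$ is dependent if reversing it creates a directed cycle. $d(D)$ is the number of dependent arcs of $D$, and $d_{\min}(G)$ is the minimum of $d(D)$ over all acyclic orientations $D$ of $G$. Generalized Mycielski graph: let $G$ have vertex set $V_0=\{\langle 0,0\rangle,\langle 0,1\rangle,\ldots,\langle 0,n-1\rangle\}$ and edge set $E_0$. For an integer $m>0$, $\mathsf{M}_m(G)$ has vertex set $V_0\cup\bigcup_{i=1}^m V_i\cup\{u\}$, where $V_i=\{\langle i,j\rangle : 0\leq j\leq n-1\}$, and edge set $E_0\cup\bigcup_{i=1}^m E_i\cup\{\langle m,j\rangle u : 0\leq j\leq n-1\}$, where $E_i=\{\langle i-1,j\rangle\langle i,k\rangle : \langle 0,j\rangle\langle 0,k\rangle\in E_0\}$ for $1\leq i\leq m$ (for each edge of $E_0$ both orders of $j,k$ are used). *)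

(* Defs.v *)
From mathcomp Require Import all_boot.

Set Implicit Arguments.
Unset Strict Implicit.
Unset Printing Implicit Defensive.

Record sgraph := SGraph {
  vertex :> finType;
  adj : rel vertex;
  adj_sym : symmetric adj;
  adj_irr : irreflexive adj }.

Definition edges (G : sgraph) : {set {set G}} :=
  [set [set p.1; p.2] | p : G * G & adj p.1 p.2].

Definition triangle_free (G : sgraph) : Prop :=
  forall x y z : G, ~ [/\ adj x y, adj y z & adj z x].

Section Digraph.
Variable T : finType.
Implicit Types D : {set T * T}.

Definition arc_rel D : rel T := fun x y => (x, y) \in D.

(* A directed cycle has no repeated vertex, hence length at most #|T|; the
   bound makes the quantification finite (see has_dicycleP). *)
Definition has_dicycle D : bool :=
  [exists n : 'I_#|T|, exists c : n.+1.-tuple T, ucycleb (arc_rel D) c].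

Lemma has_dicycleP D :
  reflect (exists2 c : seq T, c != [::] & ucycle (arc_rel D) c)
          (has_dicycle D).
Proof.
apply: (iffP existsP) => [[n /existsP[c Dc]]|[c c0 Dc]].
  by exists c => //; rewrite -size_eq0 size_tuple.
have sc : (size c).-1.+1 = size c by rewrite prednK // lt0n size_eq0.
have ltc : (size c).-1 < #|T|.
  by rewrite sc; case/andP: Dc => _ /card_uniqP <-; apply: max_card.
exists (Ordinal ltc); apply/existsP.
have szc : size c == (Ordinal ltc).+1 by rewrite /= sc.
by exists (Tuple szc).
Qed.

Definition reverse_arc D (a : T * T) : {set T * T} :=
  (a.2, a.1) |: (D :\ a).

Definition dependent D (a : T * T) : bool := has_dicycle (reverse_arc D a).

Definition num_dependent D : nat := #|[set a in D | dependent D a]|.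

End Digraph.

Section DMin.
Variable G : sgraph.

Definition orientation (D : {set G * G}) : bool :=
  [forall x : G, forall y : G,
    (adj x y == ((x, y) \in D) || ((y, x) \in D)) &&
    ~~ (((x, y) \in D) && ((y, x) \in D))].

Definition acyclic_orientation (D : {set G * G}) : bool :=
  orientation D && ~~ has_dicycle D.

Definition attains_dependent (k : nat) : bool :=
  [exists D : {set G * G}, acyclic_orientation D && (num_dependent D == k)].

Lemma acyclic_orientation_exists : exists D, acyclic_orientation D.
Proof.
pose lt := [rel x y : G | enum_rank x < enum_rank y].
exists [set p : G * G | adj p.1 p.2 && lt p.1 p.2]; apply/andP; split.
  apply/forallP=> x; apply/forallP=> y; rewrite !inE /= [adj y x]adj_sym.
  case: (boolP (adj x y)) => //= Axy.
  case: ltngtP => // /val_inj/enum_rank_inj eqxy.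
  by rewrite eqxy adj_irr in Axy.
apply/has_dicycleP=> -[[|x p] // _ /andP[/= Dp _]].
have lt_tr : transitive lt by move=> y x' z /=; apply: ltn_trans.
have sub : subrel (arc_rel [set q : G * G | adj q.1 q.2 && lt q.1 q.2]) lt.
  by move=> y z; rewrite /arc_rel inE => /andP[].
have /allP/(_ x) := order_path_min lt_tr (sub_path sub Dp).
by rewrite mem_rcons inE eqxx /= ltnn => /(_ isT).
Qed.

Lemma attains_dependent_exists : exists k, attains_dependent k.
Proof.
have [D acD] := acyclic_orientation_exists.
by exists (num_dependent D); apply/existsP; exists D; rewrite acD eqxx.
Qed.

Definition d_min : nat := ex_minn attains_dependent_exists.

End DMin.

(* Some (i, x) is the copy of x in level i (0 <= i <= m); None is the apex u. *)
Section Mycielski.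
Variables (m : nat) (G : sgraph).

Definition mycielski_vertex : finType := option ('I_m.+1 * G).

Definition mycielski_adj : rel mycielski_vertex := fun a b =>
  match a, b with
  | Some (i, x), Some (k, y) =>
      [|| (i == 0 :> nat) && (k == 0 :> nat), k == i.+1 :> nat
        | i == k.+1 :> nat] && adj x y
  | Some (i, _), None | None, Some (i, _) => i == m :> nat
  | None, None => false
  end.

Lemma mycielski_adj_sym : symmetric mycielski_adj.
Proof.
move=> [[i x]|] [[k y]|] //=.
by rewrite adj_sym andbC [in RHS]andbC; congr (_ && _);
  rewrite [_ && (k == 0 :> nat)]andbC [(k == i.+1 :> nat) || _]orbC.
Qed.

Lemma mycielski_adj_irr : irreflexive mycielski_adj.
Proof. by move=> [[i x]|] //=; rewrite adj_irr andbF. Qed.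

Definition mycielski : sgraph := SGraph mycielski_adj_sym mycielski_adj_irr.

End Mycielski.

(* Main.v *)
Require Import Defs.
From mathcomp Require Import all_boot.

(** Lifting an independent set [J] of [G] from level 0 to level 1 of the
    Mycielski graph yields another copy of [G], which therefore also carries at
    least [d = d_min G] dependent arcs. Let [A] be the set of dependent arcs
    inside level 0. The lift along [J] creates at least [d + t - #|A|] dependent
    arcs outside level 0, where [t] counts the arcs of [A] that meet [J].
    If [#|A| = d], the lifts of the two ends of one arc of [A] give two such
    arcs. If [#|A| = d + 1], triangle-freeness provides an independent [J]
    meeting two arcs of [A]. *)

Set Implicit Arguments.
Unset Strict Implicit.
Unset Printing Implicit Defensive.

Lemma has_dicycle_inj (T U : finType) (f : T -> U)
    (D : {set T * T}) (D' : {set U * U}) :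
  injective f -> (forall x y, (x, y) \in D -> (f x, f y) \in D') ->
  has_dicycle D -> has_dicycle D'.
Proof.
move=> f_inj fD /has_dicycleP[c c0 /andP[Dc Uc]]; apply/has_dicycleP.
exists (map f c); first by case: c c0 {Dc Uc}.
rewrite /ucycle map_inj_uniq // Uc andbT cycle_map.
by apply: sub_cycle Dc => x y; apply: fD.
Qed.

Definition dependent_arcs (T : finType) (D : {set T * T}) : {set T * T} :=
  [set a in D | dependent D a].

Definition within (T U : finType) (f : T -> U) : pred (U * U) :=
  fun a => (a.1 \in codom f) && (a.2 \in codom f).

Lemma orientation_adj (G : sgraph) (D : {set G * G}) (x y : G) :
  orientation D -> (x, y) \in D -> adj x y.
Proof. by move=> /forallP/(_ x)/forallP/(_ y)/andP[/eqP-> _] ->. Qed.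

(** Pulling [D] back along [f] gives an acyclic orientation of [G], and a directed cycle created by
    reversing one of its arcs is carried by [f] to a cycle created by reversing the image arc. *)
Lemma d_min_le_embedding (G H : sgraph) (f : G -> H) (D : {set H * H}) :
  injective f -> {homo f : x y / adj x y} -> acyclic_orientation D ->
  d_min G <= #|[set a in dependent_arcs D | within f a]|.
Proof.
move=> f_inj f_adj /andP[oD acD].
(* The image of [f] need not be an induced subgraph, so adjacency in [G] is imposed separately. *)
pose D' := [set p : G * G | adj p.1 p.2 && ((f p.1, f p.2) \in D)].
have D'D x y : (x, y) \in D' -> (f x, f y) \in D by rewrite inE => /andP[].
have aoD' : acyclic_orientation D'.
  apply/andP; split; last by apply: contra acD; apply: has_dicycle_inj D'D.
  apply/forallP=> x; apply/forallP=> y; rewrite !inE /= [adj y x]adj_sym.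
  case: (boolP (adj x y)) => //= /f_adj fxy.
  by move/forallP/(_ (f x))/forallP/(_ (f y)): oD; rewrite fxy.
pose ff (p : G * G) := (f p.1, f p.2).
have ff_inj : injective ff by move=> [x y] [z w] [/f_inj-> /f_inj->].
apply: (@leq_trans (num_dependent D')).
  rewrite /d_min; case: ex_minnP => k _; apply.
  by apply/existsP; exists D'; rewrite aoD' /=.
rewrite /num_dependent -(card_imset _ ff_inj); apply/subset_leq_card/subsetP.
move=> _ /imsetP[[x y] /setIdP[Dxy dep] ->].
rewrite !inE /within /= !codom_f D'D //= andbT.
apply: has_dicycle_inj f_inj _ dep => z w /setU1P[[-> ->]|].
  exact: setU11.
case/setD1P => neq Dzw; apply/setU1P; right.
by rewrite !inE D'D // andbT -/(ff (z, w)) -/(ff (x, y)) (inj_eq ff_inj).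
Qed.

Definition independent (G : sgraph) (J : {set G}) : Prop :=
  {in J &, forall x y, ~~ adj x y}.

Lemma independent1 (G : sgraph) (x : G) : independent [set x].
Proof. by move=> _ _ /set1P-> /set1P->; rewrite adj_irr. Qed.

Lemma independent2 (G : sgraph) (x y : G) :
  ~~ adj x y -> independent [set x; y].
Proof.
by move=> xy _ _ /set2P[]-> /set2P[]->; rewrite ?adj_irr // adj_sym.
Qed.

Section Lift.
Variables (G : sgraph) (m : nat).
Local Notation M := (mycielski m.+1 G).

(** For [J = set0] this is the inclusion of level 0; the height [m.+1] ensures that level 1
    exists. *)
Definition lift_set (J : {set G}) (x : G) : M :=
  Some (if x \in J then Ordinal (isT : 1 < m.+2) else ord0, x).

Lemma lift_set_inj J : injective (lift_set J).
Proof. by move=> x y []. Qed.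

(** Edges within level 0 and between levels 0 and 1 copy those of [G], but level 1 spans no edge, so
    no edge of [G] may have both ends in [J]. *)
Lemma lift_set_adj J : independent J -> {homo lift_set J : x y / adj x y}.
Proof.
move=> indJ x y xy; rewrite /lift_set /= xy andbT.
case: ifP => xJ; case: ifP => yJ //.
by have := indJ x y xJ yJ; rewrite xy.
Qed.

Lemma mem_codom_lift_set (J : {set G}) i x :
  (Some (i, x) \in codom (lift_set J)) = (i == (x \in J) :> nat).
Proof.
apply/codomP/eqP => [[y [-> <-]]|ix]; first by case: ifP.
exists x; rewrite /lift_set; congr (Some (_, _)).
by apply: val_inj; rewrite /= ix; case: ifP.
Qed.

Lemma within_lift0P (a : M * M) :
  reflect (exists x y, a = (lift_set set0 x, lift_set set0 y))
          (within (lift_set set0) a).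
Proof.
apply: (iffP andP) => [[/codomP[x ax] /codomP[y ay]]|[x [y ->]]].
  by exists x, y; rewrite -ax -ay; case: a {ax ay}.
by rewrite /= !codom_f.
Qed.

Lemma lift0_notin_codom (J : {set G}) x :
  x \in J -> lift_set set0 x \notin codom (lift_set J).
Proof. by move=> xJ; rewrite mem_codom_lift_set inE xJ. Qed.

(** The lift of [[set j]] leaves level 0 only at the copy of [j]. Hence lifts of distinct singletons
    create disjoint sets of new arcs. *)
Lemma codom_lift_set1I j k v :
  j != k -> v \in codom (lift_set [set j]) -> v \in codom (lift_set [set k]) ->
  v \in codom (lift_set set0).
Proof.
move=> jk /codomP[x ->]; rewrite !mem_codom_lift_set !inE.
by case: (x =P j) => // ->; rewrite (negPf jk).
Qed.

Variable D : {set M * M}.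
Hypothesis aoD : acyclic_orientation D.
Local Notation S := (dependent_arcs D).

Definition base_arcs : {set M * M} := [set a in S | within (lift_set set0) a].

Definition new_arcs (J : {set G}) : {set M * M} :=
  [set a in S | within (lift_set J) a] :\: base_arcs.

Lemma base_arcs_adj x y :
  (lift_set set0 x, lift_set set0 y) \in base_arcs -> adj x y.
Proof.
case/andP: aoD => oD _; rewrite !inE => /andP[/andP[Dxy _] _].
by have := orientation_adj oD Dxy; rewrite /= => /andP[].
Qed.

Lemma d_min_le_base_arcs : d_min G <= #|base_arcs|.
Proof.
apply: d_min_le_embedding aoD; first exact: lift_set_inj.
by apply: lift_set_adj => x y; rewrite inE.
Qed.

(** The lifted copy carries at least [d_min G] dependent arcs; those lying in [base_arcs] avoid [B],
    and the others are new. *)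
Lemma card_new_arcs (J : {set G}) (B : {set M * M}) : independent J ->
  B \subset base_arcs -> (forall a, a \in B -> ~~ within (lift_set J) a) ->
  d_min G + #|B| <= #|base_arcs| + #|new_arcs J|.
Proof.
move=> indJ BA BJ.
have := d_min_le_embedding (@lift_set_inj J) (lift_set_adj indJ) aoD.
set W := [set a in S | _]; rewrite -(cardsID base_arcs W) => dW.
rewrite -(cardsID W base_arcs) setIC addnAC leq_add //.
apply/subset_leq_card/subsetP => a aB.
by rewrite inE (subsetP BA) // andbT inE negb_and (BJ a aB) orbT.
Qed.

Lemma card_base_new_arcs J : #|base_arcs| + #|new_arcs J| <= num_dependent D.
Proof.
rewrite -[num_dependent D]/#|S| -(cardsID base_arcs S).
apply: leq_add; apply/subset_leq_card/subsetP => a.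
  by rewrite !inE => /andP[-> ->].
by rewrite !inE => /andP[-> /andP[->]].
Qed.

Lemma card_base_new_arcs2 j k : j != k ->
  #|base_arcs| + (#|new_arcs [set j]| + #|new_arcs [set k]|)
    <= num_dependent D.
Proof.
move=> jk; have dis : [disjoint new_arcs [set j] & new_arcs [set k]].
  rewrite -setI_eq0; apply/eqP/setP => a; rewrite in_set0; apply/negP.
  case/setIP=> /setDP[/setIdP[aS /andP[j1 j2]] /negP aA].
  case/setDP=> /setIdP[_ /andP[k1 k2]] _; apply: aA.
  rewrite inE aS /=; apply/andP; split; first exact: codom_lift_set1I jk j1 k1.
  exact: codom_lift_set1I jk j2 k2.
rewrite -[num_dependent D]/#|S| -(cardsID base_arcs S).
(* Disjointness is the equality case of the union bound on cardinals. *)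
move: dis; rewrite -leq_card_setU => /eqP <-.
apply: leq_add; apply/subset_leq_card/subsetP => a.
  by rewrite !inE => /andP[-> ->].
by rewrite !inE => /orP[] /andP[-> /andP[->]].
Qed.

End Lift.

Theorem theorem12 (G : sgraph) (m : nat) (hm : 1 <= m)
  (hG : triangle_free G) (hE : 2 <= #|edges G|) (hd : 1 <= d_min G) :
  d_min G + 2 <= d_min (mycielski m G).
Proof.
case: m hm => // m _; rewrite [leqRHS]/d_min.
case: ex_minnP => _ /existsP[D /andP[aoD /eqP <-]] _.
have dA := d_min_le_base_arcs aoD.
have [a aA] : exists a, a \in base_arcs D.
  by apply/set0Pn; rewrite -card_gt0 (leq_trans hd).
have /setIdP[_ /within_lift0P[x [y def_a]]] := aA.
have Axy : adj x y by apply: (base_arcs_adj aoD); rewrite -def_a.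
have [Ad|A_neq_d] := eqVneq (d_min G) #|base_arcs D|.
  have nxy : x != y by apply: contraTneq Axy => ->; rewrite adj_irr.
  (* Lifting an end of [a] removes [a] from the copy of [G]; with exactly [d_min G] arcs in level 0,
     a new one must replace it. *)
  have new v : v \in [:: x; y] -> 0 < #|new_arcs D [set v]|.
    move=> v_a; have := card_new_arcs (B := [set a]) aoD (@independent1 G v).
    rewrite sub1set cards1 Ad leq_add2l; apply=> // _ /set1P->.
    rewrite def_a negb_and /=; move: v_a; rewrite !inE.
    by case/orP=> /eqP->; rewrite (lift0_notin_codom m (set11 _)) ?orbT.
  apply: leq_trans (card_base_new_arcs2 D nxy); rewrite Ad leq_add2l.
  by apply: (@leq_add 1 1); apply: new; rewrite !inE eqxx ?orbT.
have {dA A_neq_d} dA : d_min G < #|base_arcs D| by rewrite ltn_neqAle A_neq_d.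
(* Now level 0 has more than [d_min G >= 1] dependent arcs, so there is a second one. *)
have [b /setD1P[ba bA]] : exists b, b \in base_arcs D :\ a.
  apply/set0Pn; rewrite -card_gt0.
  by move: (leq_trans hd (ltnW dA)) (leq_ltn_trans hd dA);
    rewrite (cardsD1 a) aA.
have /setIdP[_ /within_lift0P[z [w def_b]]] := bA.
have Azw : adj z w by apply: (base_arcs_adj aoD); rewrite -def_b.
(* Otherwise [x], [z], [w] would form a triangle. If [a] and [b] share the end [x], then [v = x] is
   possible and the lifted set is a singleton. *)
have [v v_b Nxv] : exists2 v, v \in [:: z; w] & ~~ adj x v.
  have [Axz|] := boolP (adj x z); last by exists z; rewrite ?inE ?eqxx.
  exists w; first by rewrite !inE eqxx orbT.
  by apply/negP=> Axw; case: (hG x z w); rewrite Axz Azw adj_sym.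
have := card_new_arcs (B := [set a; b]) aoD (independent2 Nxv).
rewrite subUset !sub1set aA bA cards2 eq_sym ba => lb.
apply: leq_trans (lb isT _) (card_base_new_arcs D _) => c.
have xJ := lift0_notin_codom m (set21 x v).
have vJ := lift0_notin_codom m (set22 x v).
case/set2P=> ->; rewrite ?def_a ?def_b negb_and /= ?xJ //.
by move: v_b; rewrite !inE => /orP[] /eqP <-; rewrite vJ ?orbT.
Qed.
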